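(* Let $d=2^n$ and let $A,B,C,D$ be linear operators on the $n$-qubit space $(\mathbb{C}^2)^{\otimes n}$ such that $A$ and $B$ have no overlap, i.e. $A$ and $B$ act nontrivially only on disjoint sets of qubits. Then $$\langle A\tilde BC\tilde D\rangle_{\mathrm{Pauli}}=\langle AC\rangle\,\langle BD\rangle .$$
   Context: $\mathcal{P}$ denotes the set of the $4^n=d^2$ operators $P_1\otimes\cdots\otimes P_n$ with each $P_j\in\{I,X,Y,Z\}$. For an operator $O$, $\langle O\rangle=\frac1d\mathrm{tr}\{O\}$. The Pauli-averaged four-point out-of-time-order correlator is $\langle A\tilde BC\tilde D\rangle_{\mathrm{Pauli}}=\frac1{d^2}\sum_{P\in\mathcal{P}}\frac1d\mathrm{tr}\{A\,P^\dagger BP\,C\,P^\dagger DP\}$. *)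

(* Defs.v *)
From HB Require Import structures.
From mathcomp Require Import all_boot all_order all_algebra.
From mathcomp Require Import sesquilinear spectral.
From mathcomp Require Import reals.
From mathcomp Require Import complex.

Set Implicit Arguments.
Unset Strict Implicit.
Unset Printing Implicit Defensive.

Import Order.TTheory GRing.Theory Num.Theory.
Local Open Scope ring_scope.
Local Open Scope complex_scope.
Local Open Scope sesquilinear_scope.

(* Computational basis of the Hilbert space (C^2)^{(x) I} of the qubits
   labelled by I: the basis vector |x> has qubit i in state |x i>.  Operators
   are square matrices whose rows and columns are the elements of [basis I],
   numbered by [enum_rank]; [state] recovers the element from its number. *)
Notation basis I := {ffun I -> 'I_2}.
Notation operator R I := 'M[R[i]]_#|{: basis I}|.

Definition state (I : finType) (x : 'I_#|{: basis I}|) : basis I := enum_val x.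

Lemma card_basis n : #|{: basis 'I_n}| = (2 ^ n)%N.
Proof. by rewrite card_ffun !card_ord. Qed.

Section Qubits.
Variable R : rcfType.

Definition mx22 (a b c d : R[i]) : 'M[R[i]]_2 :=
  \matrix_(i < 2, j < 2) (if i == 0 then if j == 0 then a else b
                          else if j == 0 then c else d).

Definition pauliX : 'M[R[i]]_2 := mx22 0 1 1 0.
Definition pauliY : 'M[R[i]]_2 := mx22 0 (- 'i) 'i 0.
Definition pauliZ : 'M[R[i]]_2 := mx22 1 0 0 (- 1).
Definition pauli1 (k : 'I_4) : 'M[R[i]]_2 :=
  tnth [tuple 1%:M; pauliX; pauliY; pauliZ] k.

(* F_1 (x) ... (x) F_n : <x| (x)_i F_i |y> = \prod_i <x_i| F_i |y_i>. *)
Definition tensor_op (I : finType) (F : I -> 'M[R[i]]_2) : operator R I :=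
  \matrix_(x, y) \prod_(i : I) F i (state x i) (state y i).

(* s ranges over the 4^n words in I, X, Y, Z. *)
Definition pauli_string n (s : {ffun 'I_n -> 'I_4}) : operator R 'I_n :=
  tensor_op (fun i => pauli1 (s i)).

Definition basis_restr (I : finType) (S : {set I}) (x : basis I) :
    basis {i : I | i \in S} :=
  [ffun i => x (val i)].

(* a (x) b, for a acting on the qubits in S and b on the remaining ones. *)
Definition bipartite_op (I : finType) (S : {set I})
    (a : operator R {i : I | i \in S}) (b : operator R {i : I | i \in ~: S}) :
    operator R I :=
  \matrix_(x, y)
    (a (enum_rank (basis_restr S (state x)))
       (enum_rank (basis_restr S (state y))) *
     b (enum_rank (basis_restr (~: S) (state x)))
       (enum_rank (basis_restr (~: S) (state y)))).

Definition acts_only_on (I : finType) (S : {set I}) (A : operator R I) : Prop :=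
  exists a : operator R {i : I | i \in S}, A = bipartite_op a 1%:M.

Definition no_overlap (I : finType) (A B : operator R I) : Prop :=
  exists S T : {set I},
    [/\ [disjoint S & T], acts_only_on S A & acts_only_on T B].

Definition avg n (O : operator R 'I_n) : R[i] := (2 ^ n)%:R^-1 * \tr O.

Definition otoc_pauli n (A B C D : operator R 'I_n) : R[i] :=
  ((2 ^ n) ^ 2)%:R^-1 *
  \sum_(s : {ffun 'I_n -> 'I_4})
    let P := pauli_string s in
    avg (A *m (P^t* *m B *m P) *m C *m (P^t* *m D *m P)).

End Qubits.

(* Main.v *)
Require Import Defs.
From mathcomp Require Import all_boot all_order all_algebra.
From mathcomp Require Import reals complex.
From mathcomp Require Import sesquilinear spectral ring.

Set Implicit Arguments.
Unset Strict Implicit.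
Unset Printing Implicit Defensive.

(** Expand B and D in Pauli strings, B = sum_s b_s P_s and D = sum_t d_t P_t.
    Conjugation by P multiplies a string by a sign, and these signs are
    orthogonal under averaging over P, so only s = t survives: the correlator is
    sum_s b_s d_s <A P_s C P_s>.  If b_s is nonzero then P_s is supported where B
    acts, hence commutes with A, and <A P_s C P_s> = <A C>; what is left is
    sum_s b_s d_s = <B D>. *)

Import GRing.Theory Num.Theory.
Local Open Scope ring_scope.
Local Open Scope complex_scope.
Local Open Scope sesquilinear_scope.

(** * Sums over basis states and products of tensor operators *)

Lemma sum_state (V : nmodType) (I : finType) (f : 'I_#|{: basis I}| -> V) :
  \sum_x f x = \sum_(y : basis I) f (enum_rank y).
Proof.
by rewrite (reindex enum_rank) //; exists enum_val => x _; rewrite ?enum_rankK ?enum_valK.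
Qed.

Lemma tensor_op_mul (R : rcfType) (I : finType) (F G : I -> 'M[R[i]]_2) :
  tensor_op F *m tensor_op G = tensor_op (fun i => F i *m G i).
Proof.
apply/matrixP => x z; rewrite !mxE sum_state.
under [RHS]eq_bigr do rewrite mxE.
rewrite bigA_distr_bigA; apply: eq_bigr => y _.
by rewrite !mxE -big_split /state enum_rankK.
Qed.

(** * One-qubit Pauli matrices *)

Lemma ord4P (P : 'I_4 -> Prop) :
  P 0 -> P 1 -> P 2%:R -> P 3%:R -> forall k, P k.
Proof.
move=> P0 P1 P2 P3 [[|[|[|[|k]]]] hk] //.
- by rewrite (_ : Ordinal hk = 0) //; apply: val_inj.
- by rewrite (_ : Ordinal hk = 1) //; apply: val_inj.
- by rewrite (_ : Ordinal hk = 2%:R) //; apply: val_inj.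
- by rewrite (_ : Ordinal hk = 3%:R) //; apply: val_inj.
Qed.

Lemma ord2P (P : 'I_2 -> Prop) : P 0 -> P 1 -> forall k, P k.
Proof.
move=> P0 P1 [[|[|k]] hk] //.
- by rewrite (_ : Ordinal hk = 0) //; apply: val_inj.
- by rewrite (_ : Ordinal hk = 1) //; apply: val_inj.
Qed.

(** Two Pauli matrices anticommute exactly when they are distinct and neither is the identity. *)
Definition pauli_sign (R : rcfType) (k l : 'I_4) : R[i] :=
  (-1) ^+ [&& k != 0, l != 0 & k != l].

Lemma mul_mx22 (R : rcfType) (a b c d a' b' c' d' : R[i]) :
  mx22 a b c d *m mx22 a' b' c' d' =
  mx22 (a * a' + b * c') (a * b' + b * d') (c * a' + d * c') (c * b' + d * d').
Proof.
by apply/matrixP; apply: ord2P; apply: ord2P;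
  rewrite !mxE !big_ord_recl big_ord0 !mxE addr0.
Qed.

Lemma scale_mx22 (R : rcfType) (x a b c d : R[i]) :
  x *: mx22 a b c d = mx22 (x * a) (x * b) (x * c) (x * d).
Proof. by apply/matrixP; apply: ord2P; apply: ord2P; rewrite !mxE. Qed.

Lemma mx22_1 (R : rcfType) : 1%:M = mx22 1 0 0 1 :> 'M[R[i]]_2.
Proof. by apply/matrixP; apply: ord2P; apply: ord2P; rewrite !mxE. Qed.

Lemma pauli1_herm (R : rcfType) (k : 'I_4) (x y : 'I_2) :
  (pauli1 R k x y)^* = pauli1 R k y x.
Proof.
move: k x y; apply: ord4P; apply: ord2P; apply: ord2P;
 rewrite /pauli1 !(tnth_nth 0) /= ?mx22_1 !mxE /= ?rmorph0 ?rmorph1 ?rmorphN ?rmorph1 //;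
 by rewrite -[RHS]/(_ +i* _) ?oppr0 ?opprK.
Qed.

Lemma pauli1_conj (R : rcfType) (k l : 'I_4) :
  pauli1 R k *m pauli1 R l *m pauli1 R k = pauli_sign R k l *: pauli1 R l.
Proof.
have ii : 'i * 'i = -1 :> R[i] by rewrite -expr2 sqrCi.
move: k l; apply: ord4P; apply: ord4P;
 rewrite /pauli_sign /= /pauli1 !(tnth_nth 0) /= /pauliX /pauliY /pauliZ ?mx22_1
  ?complexiE !mul_mx22 scale_mx22; congr mx22; rewrite ?expr0 ?expr1; ring: ii.
Qed.

Lemma pauli1_swap (R : rcfType) (x y z w : 'I_2) :
  \sum_k pauli1 R k z w * pauli1 R k x y = 2%:R * ((z == y) && (w == x))%:R.
Proof.
have ii : 'i * 'i = -1 :> R[i] by rewrite -expr2 sqrCi.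
rewrite !big_ord_recl big_ord0 /pauli1 !(tnth_nth 0) /= ?mx22_1 /pauliY ?complexiE.
move: x y z w; do 4 apply: ord2P; rewrite !mxE /=; ring: ii.
Qed.

(** The maps [k] to [pauli_sign R k l] are the four characters of the Klein group, with I, X, Y, Z
    as its elements. *)
Lemma pauli_sign_orth (R : rcfType) (l m : 'I_4) :
  \sum_k pauli_sign R k l * pauli_sign R k m = 4%:R * (l == m)%:R.
Proof.
rewrite !big_ord_recl big_ord0 /pauli_sign /=.
move: l m; do 2 apply: ord4P; rewrite /= ?expr0 ?expr1; ring.
Qed.

(** * Tensor operators on many qubits, and commutation on disjoint supports *)

Lemma tensor_op_scale (R : rcfType) (I : finType) (c : I -> R[i])
    (F : I -> 'M[R[i]]_2) :
  tensor_op (fun i => c i *: F i) = (\prod_i c i) *: tensor_op F.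
Proof.
apply/matrixP => x y; rewrite !mxE -big_split.
by apply: eq_bigr => i _; rewrite mxE.
Qed.

Lemma ffun_neqP (I : finType) (T : eqType) (f g : {ffun I -> T}) :
  f != g -> exists i, f i != g i.
Proof.
move=> fg; apply/existsP; apply: contraNT fg; rewrite negb_exists => /forallP fg.
by apply/eqP/ffunP => i; apply/eqP; rewrite -[_ == _]negbK fg.
Qed.

Lemma prod_eq (R : comNzRingType) (I : finType) (T : eqType)
    (f g : {ffun I -> T}) :
  \prod_i (f i == g i)%:R = (f == g)%:R :> R.
Proof.
have [->|/ffun_neqP[i fgi]] := eqVneq f g.
  by apply: big1 => i _; rewrite eqxx.
by rewrite (bigD1 i) //= (negPf fgi) mul0r.
Qed.

Lemma tensor_op1 (R : rcfType) (I : finType) :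
  tensor_op (fun _ : I => 1%:M : 'M[R[i]]_2) = 1%:M.
Proof.
apply/matrixP => x y; rewrite !mxE -(inj_eq enum_val_inj) -prod_eq.
by apply: eq_bigr => i _; rewrite mxE.
Qed.

(** In the sum over intermediate states [y] for the entry (x, z) of the left side, [A] forces [y] to
    agree with [x] off [S], and the identity factors force it to agree with [z] on [S]: one term
    survives. On the right side the roles of [x] and [z] are exchanged. *)
Lemma tensor_op_commute (R : rcfType) (I : finType) (S : {set I})
    (A : operator R I) (F : I -> 'M[R[i]]_2) :
  acts_only_on S A -> (forall i, i \in S -> F i = 1%:M) ->
  A *m tensor_op F = tensor_op F *m A.
Proof.
case=> a -> F1; apply/matrixP => x z; rewrite !mxE !sum_state.
pose glue (u v : basis I) : basis I := [ffun i => if i \in S then u i else v i].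
have gluel u v : basis_restr S (glue u v) = basis_restr S u.
  by apply/ffunP => -[i iS]; rewrite !ffunE /= iS.
have gluer u v : basis_restr (~: S) (glue u v) = basis_restr (~: S) v.
  apply/ffunP => -[i iS]; rewrite !ffunE /=.
  by move: (iS); rewrite inE => /negPf ->.
have glueP u v y : basis_restr S y = basis_restr S u ->
    basis_restr (~: S) y = basis_restr (~: S) v -> y = glue u v.
  move=> /ffunP yu /ffunP yv; apply/ffunP => i; rewrite ffunE.
  case: ifPn => iS; first by have := yu (Sub i iS); rewrite !ffunE.
  have iSC : i \in ~: S by rewrite inE.
  by have := yv (Sub i iSC); rewrite !ffunE.
have F0 (u v : basis I) : basis_restr S u != basis_restr S v ->
    \prod_i F i (u i) (v i) = 0.
  case/ffun_neqP=> j; rewrite !ffunE => juv.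
  by rewrite (bigD1 (val j)) //= F1 ?(valP j) // mxE (negPf juv) mul0r.
rewrite (bigD1 (glue (state z) (state x))) //= big1 ?addr0; last first.
  move=> y ynz; rewrite !mxE /state !enum_rankK (inj_eq enum_rank_inj).
  have [exy|nxy] := eqVneq (basis_restr (~: S) (enum_val x)) (basis_restr (~: S) y);
    last by rewrite mulr0 mul0r.
  rewrite F0 ?mulr0 //; apply: contra_neq ynz => eyz; exact: glueP.
rewrite [RHS](bigD1 (glue (state x) (state z))) //= big1 ?addr0; last first.
  move=> y ynz; rewrite !mxE /state !enum_rankK (inj_eq enum_rank_inj).
  have [exy|nxy] := eqVneq (basis_restr (~: S) y) (basis_restr (~: S) (enum_val z));
    last by rewrite !mulr0.
  rewrite F0 ?mul0r //; apply: contra_neq ynz => eyz; exact: glueP.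
rewrite !mxE /state !enum_rankK !gluel !gluer !eqxx mulrC; congr (_ * _).
(* Off [S] the two factors coincide; on [S] both are diagonal entries of the identity. *)
apply: eq_bigr => i _; rewrite !ffunE; case: ifPn => // iS.
by rewrite F1 // !mxE !eqxx.
Qed.

(** * Pauli strings: conjugation, signs and expansion *)

Section PauliStrings.
Variables (R : rcfType) (n : nat).
Implicit Types (s t p : {ffun 'I_n -> 'I_4}) (A B C D : operator R 'I_n).

Definition string_sign p s : R[i] := \prod_i pauli_sign R (p i) (s i).

(** The normalized Hilbert-Schmidt product of [B] with the string; strings are Hermitian, so no
    adjoint is taken. *)
Definition pauli_coef s B : R[i] := avg (pauli_string R s *m B).

Lemma pauli_string_herm s : (pauli_string R s)^t* = pauli_string R s.
Proof.
apply/matrixP => x y; rewrite !mxE rmorph_prod.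
by apply: eq_bigr => i _; exact: pauli1_herm.
Qed.

Lemma pauli_string_conj p s :
  pauli_string R p *m pauli_string R s *m pauli_string R p =
  string_sign p s *: pauli_string R s.
Proof.
rewrite !tensor_op_mul -tensor_op_scale.
by apply/matrixP => x y; rewrite !mxE; apply: eq_bigr => i _; rewrite pauli1_conj.
Qed.

Lemma pauli_string_sqr s : pauli_string R s *m pauli_string R s = 1%:M.
Proof.
rewrite tensor_op_mul -tensor_op1; apply/matrixP => x y; rewrite !mxE.
apply: eq_bigr => i _; congr fun_of_matrix.
(* Index 0 is the identity, whose conjugate by a Pauli matrix is the square of that matrix, with
   sign 1. *)
have := pauli1_conj R (s i) 0; rewrite /pauli_sign andbF expr0 scale1r.
by rewrite [pauli1 R 0]/pauli1 (tnth_nth 0) /= mulmx1.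
Qed.

Lemma string_sign_orth s t :
  \sum_p string_sign p s * string_sign p t = (4 ^ n)%:R * (s == t)%:R.
Proof.
under eq_bigr do rewrite -big_split.
(* A sum over words of a product over qubits is the product of the one-qubit sums. *)
rewrite -(bigA_distr_bigA (fun i k => pauli_sign R k (s i) * pauli_sign R k (t i))) /=.
under eq_bigr do rewrite pauli_sign_orth.
by rewrite big_split /= prodr_const card_ord natrX prod_eq.
Qed.

Lemma avg_sum (J : finType) (F : J -> operator R 'I_n) :
  avg (\sum_j F j) = \sum_j avg (F j).
Proof. by rewrite /avg linear_sum mulr_sumr. Qed.

Lemma avgZ c A : avg (c *: A) = c * avg A.
Proof. by rewrite /avg mxtraceZ mulrCA. Qed.

Lemma avgC A B : avg (A *m B) = avg (B *m A).
Proof. by rewrite /avg mxtrace_mulC. Qed.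

(* The sum of P_s (x) P_s is 2^n times the swap, which makes the strings a basis. *)
Lemma pauli_string_swap (x y z w : 'I_#|{: basis 'I_n}|) :
  \sum_s pauli_string R s z w * pauli_string R s x y =
  (2 ^ n)%:R * ((z == y) && (w == x))%:R.
Proof.
under eq_bigr do rewrite !mxE -big_split.
rewrite -(bigA_distr_bigA (fun i k => pauli1 R k (state z i) (state w i) *
  pauli1 R k (state x i) (state y i))) /=.
under eq_bigr do rewrite pauli1_swap.
rewrite big_split /= prodr_const card_ord natrX; congr (_ * _).
under eq_bigr do rewrite -mulnb natrM.
by rewrite big_split /= !prod_eq !(inj_eq enum_val_inj) -natrM mulnb.
Qed.

Lemma pauli_expansion B : B = \sum_s pauli_coef s B *: pauli_string R s.
Proof.
have d0 : (2 ^ n)%:R != 0 :> R[i] by rewrite pnatr_eq0 expn_eq0.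
apply/matrixP => x y; rewrite summxE.
under eq_bigr do rewrite mxE /pauli_coef /avg -mulrA.
rewrite -mulr_sumr; apply: (mulfI d0); rewrite mulVKf //.
(* The trace is opened over the entries of [B] and the sum over strings moved innermost, where the
   swap keeps only [z = y], [w = x]. *)
transitivity (\sum_z \sum_w B w z * \sum_s pauli_string R s z w * pauli_string R s x y).
  under eq_bigr do under eq_bigr do rewrite pauli_string_swap.
  rewrite (bigD1 y) //= (bigD1 x) //= !eqxx mulr1 mulrC big1 => [|w wx].
    rewrite addr0 big1 ?addr0 // => z zy.
    by apply: big1 => w _; rewrite (negPf zy) !mulr0.
  by rewrite (negPf wx) andbF !mulr0.
symmetry; under eq_bigr do rewrite mulr_suml.
rewrite exchange_big; apply: eq_bigr => z _.
under eq_bigr do rewrite mxE mulr_suml.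
rewrite exchange_big; apply: eq_bigr => w _; rewrite mulr_sumr.
by apply: eq_bigr => s _; ring.
Qed.

Lemma avg_mul_pauli_coef B D :
  avg (B *m D) = \sum_s pauli_coef s B * pauli_coef s D.
Proof.
(* Only [B] is expanded: each remaining average is a coefficient of [D] by definition. *)
rewrite {1}(pauli_expansion B) mulmx_suml avg_sum.
by apply: eq_bigr => s _; rewrite -scalemxAl avgZ.
Qed.

Lemma pauli_string_twist p B :
  pauli_string R p *m B *m pauli_string R p =
  \sum_s (pauli_coef s B * string_sign p s) *: pauli_string R s.
Proof.
rewrite {1}(pauli_expansion B) mulmx_sumr mulmx_suml; apply: eq_bigr => s _.
by rewrite -scalemxAr -scalemxAl pauli_string_conj scalerA.
Qed.

(** * Averaging over strings, and supports of coefficients *)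

Lemma pauli_twirl A B C D :
  otoc_pauli A B C D = \sum_s pauli_coef s B * pauli_coef s D *
    avg (A *m pauli_string R s *m C *m pauli_string R s).
Proof.
have d0 : ((2 ^ n) ^ 2)%:R != 0 :> R[i] by rewrite pnatr_eq0 !expn_eq0.
rewrite /otoc_pauli; apply: (mulfI d0); rewrite mulVKf //.
transitivity (\sum_p \sum_s \sum_t string_sign p s * string_sign p t *
   (pauli_coef s B * pauli_coef t D *
    avg (A *m pauli_string R s *m C *m pauli_string R t))).
  apply: eq_bigr => p _; rewrite pauli_string_herm !pauli_string_twist.
  rewrite [A *m _]mulmx_sumr !mulmx_suml avg_sum; apply: eq_bigr => s _.
  rewrite mulmx_sumr avg_sum; apply: eq_bigr => t _.
  by rewrite -!scalemxAr -!scalemxAl !avgZ; ring.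
rewrite exchange_big mulr_sumr; apply: eq_bigr => s _.
(* With the sum over [p] innermost, [t = s] yields [4 ^ n], which is the normalization
   [(2 ^ n) ^ 2], and every other [t] yields 0. *)
rewrite exchange_big (bigD1 s) //= [X in _ + X]big1 ?addr0 => [|t ts].
  by rewrite -mulr_suml string_sign_orth eqxx mulr1 expnAC.
by rewrite -mulr_suml string_sign_orth eq_sym (negPf ts) mulr0 mul0r.
Qed.

Lemma pauli_string_commute (S : {set 'I_n}) A s :
  acts_only_on S A -> (forall i, i \in S -> s i = 0) ->
  A *m pauli_string R s = pauli_string R s *m A.
Proof.
move=> AS s0; apply: tensor_op_commute AS _ => i /s0 ->.
by rewrite /pauli1 (tnth_nth 0).
Qed.

Lemma pauli_coef_outside (T : {set 'I_n}) B s i :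
  acts_only_on T B -> i \notin T -> s i != 0 -> pauli_coef s B = 0.
Proof.
move=> BT iT si.
(* P_p acts on the qubit i only, so it commutes with B, but anticommutes with P_s. *)
pose p : {ffun 'I_n -> 'I_4} :=
  [ffun j => if j == i then (if s i == 1 then 2%:R else 1) else 0].
(* At [i], [p] has the letter X, or Y if [s i] is X: in both cases neither I nor [s i]. Its other
   letters are I and contribute 1. *)
have sp : string_sign p s = -1.
  rewrite /string_sign (bigD1 i) //= big1 ?mulr1 => [|j ji].
    by move: si; rewrite ffunE eqxx /pauli_sign; move: (s i); apply: ord4P.
  by rewrite ffunE (negPf ji).
have pB : B *m pauli_string R p = pauli_string R p *m B.
  apply: pauli_string_commute BT _ => j jT; rewrite ffunE ifN //.
  by apply: contraNneq iT => <-.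
suff : pauli_coef s B = - pauli_coef s B.
  by move/eqP; rewrite eq_sym eqNr => /eqP.
(* The sign is absorbed by conjugating the string by the one of [p]; the right copy passes through
   [B], and cyclicity of the trace brings the two copies together, where they cancel. *)
rewrite -[RHS]mulN1r -sp /pauli_coef -avgZ scalemxAl -pauli_string_conj.
by rewrite -!mulmxA -pB [RHS]avgC -!mulmxA pauli_string_sqr mulmx1.
Qed.

End PauliStrings.

Theorem mainTheorem7 (R : realType) (n : nat) (A B C D : operator R 'I_n)
    (hAB : no_overlap A B) :
  otoc_pauli A B C D = avg (A *m C) * avg (B *m D).
Proof.
case: hAB => S [T [ST AS BT]].
rewrite pauli_twirl (avg_mul_pauli_coef B) [RHS]mulrC mulr_suml; apply: eq_bigr => s _.
have [->|sB] := eqVneq (pauli_coef s B) 0; first by rewrite !mul0r.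
congr (_ * _); rewrite (pauli_string_commute AS) => [|i iS].
  by rewrite avgC !mulmxA pauli_string_sqr mul1mx.
(* A letter other than I at a qubit of [S], hence outside [T], would make the coefficient of [B]
   vanish. *)
apply/eqP; apply: contraTT isT => si.
case/negP: sB; apply/eqP; apply: (pauli_coef_outside BT) si.
by rewrite (disjointFr ST).
Qed.
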